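(* Let $k$ be a positive integer and let $G$ be an edge-colored graph such that $G$ is not $\widetilde{K_4}$ and the average color degree of $G$ satisfies $\hat d(G)=\frac{1}{|V(G)|}\sum_{v\in V(G)}\hat d(v)\geq 2k-1$. If $|V(G)|\geq 4k-4$, then $G$ contains a rainbow matching of size $k$ (i.e., $r(G)\ge k$).
   Context: All graphs are finite, simple and undirected. An edge-colored graph is a graph in which each edge is assigned a color; adjacent edges may receive the same color (the coloring need not be proper). For a vertex $v$, the color degree $\hat d(v)$ is the number of distinct colors on edges incident to $v$. A rainbow matching is a matching in which no two edges have the same color, and $r(G)$ denotes the maximum size of a rainbow matching in $G$. $\widetilde{K_4}$ denotes the complete graph $K_4$ properly edge-colored with three colors so that each color class is a perfect matching (of size $2$). *)

(* Defs.v *)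
From mathcomp Require Import all_boot all_order all_algebra.

Set Implicit Arguments.
Unset Strict Implicit.
Unset Printing Implicit Defensive.

Import Order.TTheory GRing.Theory Num.Theory.
Local Open Scope ring_scope.

(* Edges are two-element vertex sets. [color] is total for convenience: only
   its values on [edges] are used below. *)
Record ecgraph (V : finType) (C : eqType) := ECGraph {
  edges : {set {set V}};
  edges_card2 : forall e, e \in edges -> #|e| = 2%N;
  color : {set V} -> C
}.

Definition num_colors (V : finType) (C : eqType) (G : ecgraph V C)
    (S : {set {set V}}) : nat :=
  size (undup [seq color G e | e in S]).

Definition color_degree (V : finType) (C : eqType) (G : ecgraph V C)
    (v : V) : nat :=
  num_colors G [set e in edges G | v \in e].

(* Equal to 0 on the graph without vertices, since x / 0 = 0 in rat. *)
Definition avg_color_degree (V : finType) (C : eqType) (G : ecgraph V C)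
    : rat :=
  (\sum_(v : V) (color_degree G v)%:R) / #|V|%:R.

Definition matching (V : finType) (C : eqType) (G : ecgraph V C)
    (M : {set {set V}}) : Prop :=
  M \subset edges G /\ trivIset M.

Definition rainbow_matching (V : finType) (C : eqType) (G : ecgraph V C)
    (M : {set {set V}}) : Prop :=
  matching G M /\ {in M &, injective (color G)}.

Definition perfect_matching (V : finType) (C : eqType) (G : ecgraph V C)
    (M : {set {set V}}) : Prop :=
  matching G M /\ cover M = [set: V].

Definition complete (V : finType) (C : eqType) (G : ecgraph V C) : Prop :=
  edges G = [set e : {set V} | #|e| == 2%N].

Definition properly_colored (V : finType) (C : eqType) (G : ecgraph V C)
    : Prop :=
  forall e f : {set V}, e \in edges G -> f \in edges G ->
    e != f -> e :&: f != set0 -> color G e != color G f.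

Definition color_class (V : finType) (C : eqType) (G : ecgraph V C) (a : C)
    : {set {set V}} :=
  [set e in edges G | color G e == a].

(* Invariant under renaming vertices and colors, so it identifies the colored
   graph up to isomorphism. *)
Definition is_K4_tilde (V : finType) (C : eqType) (G : ecgraph V C) : Prop :=
  [/\ #|V| = 4%N,
      complete G,
      properly_colored G,
      num_colors G (edges G) = 3%N
    & forall e, e \in edges G -> perfect_matching G (color_class G (color G e))].

(* Main.v *)
(* Write m = k - 1 and induct on k, on graphs whose edges lie in a vertex set S.
   Let v have maximum color degree d.  Deleting v preserves the hypotheses for
   k - 1, so there is a rainbow matching M of size m avoiding v; suppose that no
   rainbow matching has size m + 1, and call an edge free if M does not use its
   color.  The free edges at v all go to M, so d <= 2m + i, where i is the number of
   edges of M both of whose ends are joined to v by free edges, all of distinct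
   colors (the doubled edges of M).  Replacing a doubled edge e by an edge from
   v to one of its ends releases the color of e and the other end of e.
   Exchanges of this kind show that a vertex w outside M and v loses one color
   for nearly every doubled edge e: either e receives few free edges, or the
   color of e is available to w only through the n = m - i other edges of M.
   Hence the vertices outside M and v have color degree about m + n on average,
   those of M have color degree at most d <= 3m - n, and |S| >= 4m makes the
   total smaller than (2m + 1)|S|.  This needs m >= 2; for m = 1 the same degree
   bound forces every color degree to be 3, and then a properly colored K_4. *)

Require Import Defs.
From mathcomp Require Import all_boot all_order all_algebra.
From mathcomp Require Import zify.

Set Implicit Arguments.
Unset Strict Implicit.
Unset Printing Implicit Defensive.

Import Order.TTheory GRing.Theory Num.Theory.
Local Open Scope ring_scope.

(** * Rainbow matchings: removing, adding and swapping one edge *)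

Section RainbowMatchings.

Local Open Scope nat_scope.

Variables (V : finType) (C : eqType) (G : ecgraph V C).
Implicit Types (M : {set {set V}}) (e f : {set V}) (w x y z : V) (c : C) (P : pred C).

Definition adj x y : bool := [set x; y] \in edges G.
Definition col x y : C := color G [set x; y].
Definition unused M c : bool := c \notin [seq color G e | e in M].
Definition rainbow m M : Prop := rainbow_matching G M /\ #|M| = m.

Lemma adjC x y : adj x y = adj y x.
Proof. by rewrite /adj setUC. Qed.

Lemma colC x y : col x y = col y x.
Proof. by rewrite /col setUC. Qed.

Lemma adj_neq {x y} : adj x y -> x != y.
Proof. by move/edges_card2; rewrite cards2; case: (x != y). Qed.

Lemma edge_ends e : e \in edges G -> exists x y, e = [set x; y] /\ adj x y.
Proof.
move=> eG; have /eqP/cards2P[x [y [_ exy]]] := edges_card2 eG.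
by exists x, y; rewrite /adj -exy.
Qed.

Lemma edge_other e x : e \in edges G -> x \in e ->
  exists y, e = [set x; y] /\ adj x y.
Proof.
move=> eG xe; have [a [b [eab adjab]]] := edge_ends eG.
move: xe; rewrite eab !inE => /orP[]/eqP->; first by exists b.
by exists a; rewrite setUC adjC.
Qed.

Lemma unusedP M c : reflect (forall e, e \in M -> color G e != c) (unused M c).
Proof.
apply: (iffP idP) => [Mc e eM | Mc].
  by apply: contraNneq Mc => <-; apply/imageP; exists e.
by apply/imageP => -[e eM cE]; have := Mc e eM; rewrite cE eqxx.
Qed.

Lemma used_colorP M c : ~~ unused M c -> exists2 e, e \in M & c = color G e.
Proof. by rewrite negbK => /imageP[e]; exists e. Qed.

Section OneMatching.

Variables (m : nat) (M : {set {set V}}).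
Hypothesis rM : rainbow m M.

Lemma rainbow_edge e : e \in M -> e \in edges G.
Proof. by case: rM => -[[/subsetP sM _] _] _; apply: sM. Qed.

Lemma rainbow_eq e f x : e \in M -> f \in M -> x \in e -> x \in f -> e = f.
Proof.
case: rM => -[[_ /trivIsetP tM] _] _ eM fM xe xf.
apply/eqP/negPn/negP => nef; have /pred0P/(_ x) := tM e f eM fM nef.
by rewrite /= xe xf.
Qed.

Lemma rainbow_inj e f : e \in M -> f \in M -> color G e = color G f -> e = f.
Proof. by case: rM => -[_ iM] _; apply: iM. Qed.

Lemma mem_coverP x : reflect (exists2 e, e \in M & x \in e) (x \in cover M).
Proof. exact: bigcupP. Qed.

Lemma rainbowD1 e : e \in M -> rainbow m.-1 (M :\ e).
Proof.
case: rM => -[[sM tM] iM] cM eM; split; last first.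
  by rewrite -cM (cardsD1 e M) eM.
split; first split.
- exact: subset_trans (subsetDl _ _) sM.
- apply/trivIsetP => f g /setD1P[_ fM] /setD1P[_ gM].
  by move/trivIsetP: tM; apply.
- by move=> f g /setD1P[_ fM] /setD1P[_ gM]; apply: iM.
Qed.

Lemma rainbowU1 x y : adj x y -> x \notin cover M -> y \notin cover M ->
  unused M (col x y) -> rainbow m.+1 ([set x; y] |: M).
Proof.
case: rM => -[[sM tM] iM] cM xy xM yM /unusedP Mxy.
have disj f : f \in M -> [disjoint [set x; y] & f].
  move=> fM; apply/pred0P => z /=; apply/negP => /andP[].
  rewrite !inE => /orP[]/eqP-> zf.
    by move/negP: xM; apply; apply/mem_coverP; exists f.
  by move/negP: yM; apply; apply/mem_coverP; exists f.
have nM : [set x; y] \notin M.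
  by apply/negP => /Mxy; rewrite eqxx.
split; last by rewrite cardsU1 nM cM.
split; first split.
- by apply/subsetP => f /setU1P[->|/(subsetP sM)].
- apply/trivIsetP => f g /setU1P[->|fM] /setU1P[->|gM]; rewrite ?eqxx // => fg.
  + exact: disj.
  + by rewrite disjoint_sym; exact: disj.
  + by move/trivIsetP: tM; apply.
- move=> f g /setU1P[->|fM] /setU1P[->|gM] //.
  + by move=> E; have := Mxy g gM; rewrite -E eqxx.
  + by move=> E; have := Mxy f fM; rewrite E eqxx.
  + exact: iM.
Qed.

End OneMatching.

(** Replacing [e] by [xy] frees the color of [e] and its end other than [x], and spends only [y] and
    the color of [xy]. The conclusion records what is needed to chain several swaps. *)
Lemma rainbow_swap m M e x y : rainbow m M -> e \in M -> x \in e ->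
  y \notin cover M -> adj x y -> unused M (col x y) ->
  exists M', [/\ rainbow m M',
    forall z, z \notin cover M -> z != y -> z \notin cover M',
    forall z, z \in e -> z != x -> z \notin cover M',
    forall f, f \in M -> f != e -> f \in M' &
    unused M' (color G e) /\
      (forall c, unused M c -> c != col x y -> unused M' c)].
Proof.
move=> rM eM xe yM xy Mxy.
have cov z : z \in cover (M :\ e) -> z \in cover M /\ z \notin e.
  move=> /bigcupP[f /setD1P[fe fM] zf]; split; first by apply/bigcupP; exists f.
  by apply: contra fe => ze; apply/eqP; apply: (rainbow_eq rM) zf ze.
have xM : x \in cover M by apply/bigcupP; exists e.
have nxy : x != y by apply: adj_neq.
have m_gt0 : 0 < m by case: rM => _ <-; apply/card_gt0P; exists e.
exists ([set x; y] |: (M :\ e)).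
have cov' z : z \in cover ([set x; y] |: (M :\ e)) ->
    [\/ z = x, z = y | z \in cover M /\ z \notin e].
  case/bigcupP => f /setU1P[->|fM] zf.
    by move: zf; rewrite !inE => /orP[]/eqP; [constructor 1 | constructor 2].
  by apply: Or33; apply: cov; apply/bigcupP; exists f.
split.
- rewrite -(prednK m_gt0).
  apply: (rainbowU1 (rainbowD1 rM eM)) => //.
  + by apply/negP => /cov[_]; rewrite xe.
  + by apply/negP => /cov[]; rewrite (negbTE yM).
  + by apply/unusedP => f /setD1P[_]; move/unusedP: Mxy; apply.
- move=> z zM zy; apply/negP => /cov'[zE|zE|[zM' _]].
  + by rewrite zE xM in zM.
  + by rewrite zE eqxx in zy.
  + by rewrite zM' in zM.
- move=> z ze zx; apply/negP => /cov'[zE|zE|[_]].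
  + by rewrite zE eqxx in zx.
  + by move/negP: yM; apply; apply/bigcupP; exists e => //; rewrite -zE.
  + by rewrite ze.
- by move=> f fM fe; apply/setU1P; right; apply/setD1P.
- split.
    apply/unusedP => f /setU1P[->|/setD1P[fe fM]].
      by rewrite eq_sym; move/unusedP: Mxy; apply.
    by apply: contra fe => /eqP E; apply/eqP; apply: (rainbow_inj rM).
  move=> c /unusedP Mc cxy; apply/unusedP => f /setU1P[->|/setD1P[fe fM]].
    by rewrite eq_sym.
  exact: Mc.
Qed.

(** * Counting the colors that vertices send to one edge *)

Definition pcols (P : pred C) w e : seq C :=
  undup [seq col w z | z in [set z in e | adj w z && P (col w z)]].

Lemma mem_pcols P w e c : reflect
  (exists z, [/\ z \in e, adj w z, P (col w z) & c = col w z])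
  (c \in pcols P w e).
Proof.
rewrite mem_undup; apply: (iffP imageP) => [[z]|[z [ze wz Pz ->]]].
  by rewrite inE => /and3P[ze wz Pz] ->; exists z.
by exists z => //; rewrite inE ze wz.
Qed.

Lemma size_pcols_gt0 P w e : 0 < size (pcols P w e) ->
  exists z, [/\ z \in e, adj w z & P (col w z)].
Proof.
case E: (pcols P w e) => [//|c s] _.
have /mem_pcols[z [ze wz Pz _]] : c \in pcols P w e by rewrite E mem_head.
by exists z.
Qed.

Lemma size_pcols_le1 P w e c : {in pcols P w e, forall d, d = c} ->
  size (pcols P w e) <= 1.
Proof.
move=> all_c; apply: (@uniq_leq_size _ _ [:: c]) => [|d /all_c ->].
  exact: undup_uniq.
exact: mem_head.
Qed.

Lemma size_pcols_gt1 P w x y : 1 < size (pcols P w [set x; y]) ->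
  [/\ adj w x && P (col w x), adj w y && P (col w y) & col w x != col w y].
Proof.
move=> gt1.
have not1 c : ~ {in pcols P w [set x; y], forall d, d = c}.
  by move/size_pcols_le1; rewrite leqNgt gt1.
have ends d : d \in pcols P w [set x; y] ->
    (adj w x && P (col w x) /\ d = col w x) \/
    (adj w y && P (col w y) /\ d = col w y).
  by case/mem_pcols => z []; rewrite !inE => /orP[]/eqP-> -> -> ->; [left|right].
split.
- apply/negPn/negP => H.
  by apply: (not1 (col w y)) => d /ends[[]|[]] //; rewrite (negbTE H).
- apply/negPn/negP => H.
  by apply: (not1 (col w x)) => d /ends[[]|[]] //; rewrite (negbTE H).
- apply/eqP => H.
  by apply: (not1 (col w x)) => d /ends[[]|[]] // _ ->; rewrite H.
Qed.

Lemma size_pcols_le2 P w x y : size (pcols P w [set x; y]) <= 2.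
Proof.
apply: (@uniq_leq_size _ _ [:: col w x; col w y]); first exact: undup_uniq.
by move=> d /mem_pcols[z []]; rewrite !inE => /orP[]/eqP-> _ _ ->; rewrite eqxx ?orbT.
Qed.

Lemma sum_pcols_le P (R : {set V}) x y :
  \sum_(w in R) size (pcols P w [set x; y]) <=
    #|[set w in R | 0 < size (pcols P w [set x; y])]|
    + #|[set w in R | 1 < size (pcols P w [set x; y])]|.
Proof.
rewrite -!sum1dep_card !big_mkcondr /= -big_split /=.
apply: leq_sum => w _; have := size_pcols_le2 P w x y.
by case: (size _) => [|[|[|]]].
Qed.

(** This is what maximality of a matching gives at its edge [xy]: otherwise [wx] and [w'y] could be
    exchanged for [xy]. *)
Definition compatible P (R : {set V}) x y : Prop :=
  forall w w', w \in R -> w' \in R -> w != w' -> adj w x -> P (col w x) ->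
    adj w' y -> P (col w' y) -> col w x = col w' y.

(* Two vertices seeing two colors each leave no compatible color for a third. *)
Lemma card_compatible_gt1 P (R : {set V}) x y w1 w2 : compatible P R x y ->
  w1 \in R -> w2 \in R -> w1 != w2 ->
  1 < size (pcols P w1 [set x; y]) -> 1 < size (pcols P w2 [set x; y]) ->
  [set w in R | 0 < size (pcols P w [set x; y])] \subset [set w1; w2].
Proof.
move=> cP w1R w2R n12 /size_pcols_gt1[/andP[a1x p1x] /andP[a1y p1y] n1].
move=> /size_pcols_gt1[/andP[a2x p2x] /andP[a2y p2y] n2].
apply/subsetP => w; rewrite !inE => /andP[wR /size_pcols_gt0[z [ze awz pz]]].
apply/negPn/negP; rewrite negb_or => /andP[nw1 nw2].
have n21 : w2 != w1 by rewrite eq_sym.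
have E12 := cP w1 w2 w1R w2R n12 a1x p1x a2y p2y.
have E21 := cP w2 w1 w2R w1R n21 a2x p2x a1y p1y.
move: ze; rewrite !inE => /orP[]/eqP zE; rewrite {z}zE in awz pz.
  have E1 := cP w w1 wR w1R nw1 awz pz a1y p1y.
  have E2 := cP w w2 wR w2R nw2 awz pz a2y p2y.
  by move: n1; rewrite E12 -E2 E1 eqxx.
have n1w : w1 != w by rewrite eq_sym.
have n2w : w2 != w by rewrite eq_sym.
have E1 := cP w1 w w1R wR n1w a1x p1x awz pz.
have E2 := cP w2 w w2R wR n2w a2x p2x awz pz.
by move: n1; rewrite E1 -E2 E21 eqxx.
Qed.

(** If at most one vertex sends two colors, the excess over [#|R|] is at most 1. If two do, no other
    vertex contributes and the total is at most 4, which is where three vertices in [R] are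
    required. *)
Lemma sum_compatible P (R : {set V}) x y : compatible P R x y -> 2 < #|R| ->
  \sum_(w in R) size (pcols P w [set x; y]) <= #|R|.+1.
Proof.
move=> cP R3; apply: leq_trans (sum_pcols_le P R x y) _.
set A := [set w in R | 0 < _]; set B := [set w in R | 1 < _].
have sBA : B \subset A.
  by apply/subsetP => w; rewrite /A /B !inE => /andP[-> /ltnW->].
have sAR : A \subset R by apply/subsetP => w; rewrite /A inE => /andP[].
have leBA := subset_leq_card sBA; have leAR := subset_leq_card sAR.
case: (leqP #|B| 1) => [|B2]; first by lia.
case/card_gt1P: B2 => w1 [w2 [w1B w2B n12]].
move: w1B w2B; rewrite /B !inE -/B => /andP[w1R s1] /andP[w2R s2].
have sA2 := subset_leq_card (card_compatible_gt1 cP w1R w2R n12 s1 s2).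
by rewrite cards2 n12 -/A in sA2; lia.
Qed.

(** As [v] already sends two colors, a vertex of [R] sending two is the only contributor in [R];
    otherwise each contributes at most 1. *)
Lemma sum_compatible_rigid P (R : {set V}) v x y :
  compatible P (v |: R) x y -> v \notin R ->
  1 < size (pcols P v [set x; y]) ->
  \sum_(w in R) size (pcols P w [set x; y]) <=
    maxn 2 #|[set w in R | 0 < size (pcols P w [set x; y])]|.
Proof.
move=> cP vR sv; apply: leq_trans (sum_pcols_le P R x y) _.
set A := [set w in R | 0 < _]; set B := [set w in R | 1 < _].
have [->|/set0Pn[w]] := eqVneq B set0; first by rewrite cards0 addn0 leq_maxr.
rewrite /B inE -/B => /andP[wR sw].
have vw : v != w by apply: contraNneq vR => ->.
have := card_compatible_gt1 cP (setU11 _ _) (setU1r _ wR) vw sv sw.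
have sBA : B \subset A.
  by apply/subsetP => u; rewrite /A /B !inE => /andP[-> /ltnW->].
have leBA := subset_leq_card sBA.
move=> /subsetP sAw; have sA : A \subset [set w].
  apply/subsetP => u; rewrite /A inE => /andP[uR su].
  have : u \in [set v; w] by apply: sAw; rewrite !inE uR orbT.
  by rewrite !inE => /orP[/eqP uv|//]; rewrite uv (negbTE vR) in uR.
by move/subset_leq_card: sA; rewrite cards1; lia.
Qed.

End RainbowMatchings.

(** * Exchanges in a rainbow matching of maximum size *)

Section Exchange.

Local Open Scope nat_scope.

Variables (V : finType) (C : eqType) (G : ecgraph V C).
Implicit Types (e f : {set V}) (w x y z : V) (c : C) (P : pred C).
Local Notation adj := (adj G).
Local Notation col := (col G).
Local Notation unused := (unused G).
Local Notation rainbow := (rainbow G).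
Local Notation pcols := (pcols G).

Variables (m : nat) (M : {set {set V}}).
Hypothesis rM : rainbow m M.
Hypothesis maxM : forall M', ~ rainbow m.+1 M'.

Lemma augment_false M' x y : rainbow m M' -> adj x y -> x \notin cover M' ->
  y \notin cover M' -> unused M' (col x y) -> False.
Proof. by move=> rM' xy xM' yM' fxy; apply: (maxM (rainbowU1 rM' xy xM' yM' fxy)). Qed.

Lemma not_free_outside x y : adj x y -> x \notin cover M -> y \notin cover M ->
  ~~ unused M (col x y).
Proof. by move=> xy xM yM; apply/negP; apply: (augment_false rM). Qed.

Lemma free_pair a b w w' : [set a; b] \in M -> w \notin cover M ->
  w' \notin cover M -> w != w' -> adj w a -> unused M (col w a) ->
  adj w' b -> unused M (col w' b) -> col w a = col w' b.
Proof.
move=> eM wM w'M nw wa fwa w'b fw'b; apply/eqP/negPn/negP => nc.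
have nab := adj_neq (rainbow_edge rM eM).
rewrite adjC in wa; rewrite colC in fwa nc.
have [M' [rM' out ins _ [_ fr]]] := rainbow_swap rM eM (set21 a b) wM wa fwa.
apply: (augment_false rM' w'b).
- by apply: out; rewrite // eq_sym.
- by apply: ins; rewrite ?set22 // eq_sym.
- by apply: fr; rewrite // eq_sym.
Qed.

Variables (v : V) (Pv : {set V}).
Hypothesis vM : v \notin cover M.
Hypothesis adjPv : forall z, z \in Pv -> adj v z.
Hypothesis freePv : forall z, z \in Pv -> unused M (col v z).
Hypothesis injPv : {in Pv &, injective (col v)}.

Definition doubled := [set e in M | e \subset Pv].

Lemma doubledP e : e \in doubled -> e \in M /\ {subset e <= Pv}.
Proof. by rewrite inE => /andP[eM /subsetP]. Qed.

Lemma doubled_free a b w : [set a; b] \in doubled -> w \notin cover M ->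
  w != v -> adj w a -> unused M (col w a) -> col w a = col v b.
Proof.
move=> /doubledP[eM eP] wM wv wa fwa.
have bP : b \in Pv by apply: eP; rewrite set22.
by apply: free_pair; rewrite ?adjPv ?freePv.
Qed.

(* If [w' <> w], a free edge at [w'] or [v] takes over [e], so that the color of
   [e] can be used on [wz]; when [z] lies on another doubled edge, [v] then
   covers the end of that edge left free. *)
Lemma doubled_color_blocked e w z w' a : e \in doubled ->
  w \notin cover M -> w != v -> adj w z -> col w z = color G e ->
  z \notin cover (M :\: doubled) ->
  w' \notin cover M -> w' != v -> a \in e -> adj w' a -> unused M (col w' a) ->
  w' = w.
Proof.
move=> eI wM wv wz cwz zN w'M w'v ae w'a fw'a.
have [eM eP] := doubledP eI.
apply/eqP/negPn/negP => nw'w; have nww' : w != w' by rewrite eq_sym.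
have [b [eab ab]] := edge_other (rainbow_edge rM eM) ae.
have aw' : adj a w' by rewrite adjC.
have faw' : unused M (col a w') by rewrite colC.
have [M1 [rM1 out1 ins1 mem1 [fe1 fr1]]] := rainbow_swap rM eM ae w'M aw' faw'.
have [zM|zM] := boolP (z \in cover M); last first.
  have [zv|zv] := eqVneq z v.
    apply: (augment_false rM1 wz); last by rewrite cwz.
      exact: out1.
    by rewrite zv; apply: out1 => //; rewrite eq_sym.
  (* [v] rather than [w'] takes over [e] here, since [z] may be [w']. *)
  have av : adj a v by rewrite adjC; apply/adjPv/eP.
  have fav : unused M (col a v) by rewrite colC; apply/freePv/eP.
  have [M2 [rM2 out2 _ _ [fe2 _]]] := rainbow_swap rM eM ae vM av fav.
  by apply: (augment_false rM2 wz); rewrite ?cwz ?out2.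
case/bigcupP: zM => e' e'M ze'.
have e'I : e' \in doubled.
  apply/negPn/negP => e'I; move/negP: zN; apply; apply/bigcupP; exists e' => //.
  by rewrite inE e'I.
have [_ e'P] := doubledP e'I.
have [z' [ezz zz']] := edge_other (rainbow_edge rM e'M) ze'.
have z'e' : z' \in e' by rewrite ezz set22.
have nzz' := adj_neq zz'.
have z'v : adj z' v by rewrite adjC; apply/adjPv/e'P.
have fz'v : unused M (col z' v) by rewrite colC; apply/freePv/e'P.
have [ee|ne] := eqVneq e' e.
  have [M2 [rM2 out2 ins2 _ [fe2 _]]] := rainbow_swap rM e'M z'e' vM z'v fz'v.
  apply: (augment_false rM2 wz); first exact: out2.
    exact: ins2.
  by rewrite cwz -ee.
have zw : adj z w by rewrite adjC.
have fzw : unused M1 (col z w) by rewrite colC cwz.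
have wM1 : w \notin cover M1 by apply: out1.
have e'M1 : e' \in M1 by apply: mem1.
have [M2 [rM2 out2 ins2 _ [_ fr2]]] := rainbow_swap rM1 e'M1 ze' wM1 zw fzw.
have vz' : adj v z' by rewrite adjC.
apply: (augment_false rM2 vz').
- by apply: out2; rewrite 1?eq_sym // out1 // eq_sym.
- by apply: ins2; rewrite // eq_sym.
- have fvz' : unused M (col v z') by apply/freePv/e'P.
  apply: fr2.
    (* [aw'] has the color of [vb], so a clash with [vz'] would give [z' = b] by injectivity on
       [Pv], although they lie on different edges of [M]. *)
    apply: fr1 => //; rewrite (colC _ a) (doubled_free _ w'M w'v w'a fw'a (b := b)) -?eab //.
    apply: contra ne => /eqP/injPv E.
    have bE : z' = b by apply: E; [apply: e'P | apply: eP; rewrite eab set22].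
    by apply/eqP; apply: (rainbow_eq rM e'M eM z'e'); rewrite bE eab set22.
  apply: contraTneq fvz' => ->; rewrite colC cwz; apply/unusedP => /(_ e eM).
  by rewrite eqxx.
Qed.

(** [v] takes over [e] and releases its color, [w] takes over [ab] with that color, and then [w'b]
    augments. *)
Lemma doubled_free_false e a b w w' : e \in doubled -> [set a; b] \in M ->
  [set a; b] \notin doubled -> w \notin cover M -> w' \notin cover M ->
  w != v -> w' != v -> w != w' -> adj w a -> col w a = color G e ->
  adj w' b -> unused M (col w' b) -> False.
Proof.
move=> eI e'M e'I wM w'M wv w'v nww' wa cwa w'b fw'b.
have [eM eP] := doubledP eI.
have ne : [set a; b] != e by apply: contraNneq e'I => ->.
(* The colors from [v] to the ends of [e] differ, so one of them is not the color of [w'b]. *)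
have [x [xe ncx]] : exists x, x \in e /\ col v x != col w' b.
  have [x [y [exy xy]]] := edge_ends (rainbow_edge rM eM).
  have [xe ye] : x \in e /\ y \in e by rewrite exy set21 set22.
  have [cx|] := eqVneq (col v x) (col w' b); last by exists x.
  exists y; split=> //; rewrite -cx; apply: contraTneq (adj_neq xy).
  by move/(injPv (eP _ ye) (eP _ xe)) => ->; rewrite eqxx.
have xv : adj x v by rewrite adjC; apply/adjPv/eP.
have fxv : unused M (col x v) by rewrite colC; apply/freePv/eP.
have [M1 [rM1 out1 _ mem1 [fe1 fr1]]] := rainbow_swap rM eM xe vM xv fxv.
have aw : adj a w by rewrite adjC.
have faw : unused M1 (col a w) by rewrite colC cwa.
have [M2 [rM2 out2 ins2 _ [_ fr2]]] :=
  rainbow_swap rM1 (mem1 _ e'M ne) (set21 a b) (out1 _ wM wv) aw faw.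
apply: (augment_false rM2 w'b).
- by apply: out2; rewrite 1?eq_sym // out1.
- by apply: ins2; rewrite ?set22 // eq_sym (adj_neq (rainbow_edge rM e'M)).
- apply: fr2; first by apply: fr1; rewrite // (colC _ x) eq_sym.
  rewrite (colC _ a) cwa; apply: contraTneq fw'b => ->.
  by apply/unusedP => /(_ e eM); rewrite eqxx.
Qed.

(** Both colors are released at once: [v] takes over [e1] and [w2] takes over [e2]. Then [w] takes
    over [ab] with the first color and [w'b] augments with the second. *)
Lemma doubled2_false e1 e2 a b a2 w w' w2 : e1 \in doubled -> e2 \in doubled ->
  e1 != e2 -> [set a; b] \in M -> [set a; b] \notin doubled ->
  w \notin cover M -> w' \notin cover M -> w2 \notin cover M ->
  w != v -> w' != v -> w2 != v -> w != w' -> w2 != w -> w2 != w' ->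
  adj w a -> col w a = color G e1 -> adj w' b -> col w' b = color G e2 ->
  a2 \in e2 -> adj w2 a2 -> unused M (col w2 a2) -> False.
Proof.
move=> e1I e2I n12 eM eI wM w'M w2M wv w'v w2v nww' n2 n2' wa cwa w'b cw'b.
move=> a2e2 w2a2 fw2a2.
have [e1M e1P] := doubledP e1I; have [e2M e2P] := doubledP e2I.
have ne1 : [set a; b] != e1 by apply: contraNneq eI => ->.
have ne2 : [set a; b] != e2 by apply: contraNneq eI => ->.
have [x [y [exy xy]]] := edge_ends (rainbow_edge rM e1M).
have xe1 : x \in e1 by rewrite exy set21.
have xv : adj x v by rewrite adjC; apply/adjPv/e1P.
have fxv : unused M (col x v) by rewrite colC; apply/freePv/e1P.
have [M1 [rM1 out1 _ mem1 [fe1 fr1]]] := rainbow_swap rM e1M xe1 vM xv fxv.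
have [b2 [e2ab ab2]] := edge_other (rainbow_edge rM e2M) a2e2.
have b2e2 : b2 \in e2 by rewrite e2ab set22.
have c2 : col w2 a2 = col v b2.
  by apply: (doubled_free _ w2M w2v w2a2 fw2a2); rewrite -e2ab.
have a2w2 : adj a2 w2 by rewrite adjC.
(* The color of [w2a2] is that of [vb2]; it survives the first swap because [b2] and [x] are
   different points of [Pv]. *)
have f1 : unused M1 (col a2 w2).
  rewrite colC; apply: fr1 => //; rewrite c2 (colC _ x).
  apply: contra n12 => /eqP/injPv E.
  have bx : b2 = x by apply: E; [apply: e2P | apply: e1P].
  by apply/eqP; apply: (rainbow_eq rM e1M e2M xe1); rewrite -bx.
have e2M1 : e2 \in M1 by apply: mem1; rewrite // eq_sym.
have [M2 [rM2 out2 _ mem2 [fe2 fr2]]] :=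
  rainbow_swap rM1 e2M1 a2e2 (out1 _ w2M w2v) a2w2 f1.
have nf e c : e \in M -> unused M c -> color G e != c by move=> ? /unusedP; apply.
have f2 : unused M2 (col a w).
  rewrite colC cwa; apply: fr2 => //; rewrite (colC _ a2).
  exact: nf.
have aw : adj a w by rewrite adjC.
have eM2 : [set a; b] \in M2 by apply: (mem2 _ (mem1 _ eM ne1) ne2).
have wM2 : w \notin cover M2 by apply: out2; rewrite 1?eq_sym // out1.
have [M3 [rM3 out3 ins3 _ [_ fr3]]] := rainbow_swap rM2 eM2 (set21 a b) wM2 aw f2.
apply: (augment_false rM3 w'b).
- by apply: out3; rewrite 1?eq_sym // out2 1?eq_sym // out1.
- by apply: ins3; rewrite ?set22 // eq_sym (adj_neq (rainbow_edge rM eM)).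
- rewrite cw'b; apply: fr3 => //; rewrite (colC _ a) cwa.
  by apply: contra n12 => /eqP E; apply/eqP; apply: (rainbow_inj rM).
Qed.

Lemma color_degree_mem w c : reflect (exists2 z, adj w z & c = col w z)
  (c \in undup [seq color G e | e in [set e in edges G | w \in e]]).
Proof.
rewrite mem_undup; apply: (iffP imageP) => [[e]|[z wz ->]].
  rewrite inE => /andP[eG we] ->.
  by have [z [-> wz]] := edge_other eG we; exists z.
by exists [set w; z]; rewrite // inE set21 andbT.
Qed.

Lemma pcols_gt1 P w x y : adj w x -> P (col w x) -> adj w y -> P (col w y) ->
  col w x != col w y -> 1 < size (pcols P w [set x; y]).
Proof.
move=> wx Px wy Py nxy.
apply: (@uniq_leq_size _ [:: col w x; col w y]); first by rewrite /= inE nxy.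
move=> c; rewrite !inE => /orP[]/eqP->; apply/mem_pcols.
  by exists x; rewrite set21.
by exists y; rewrite set22.
Qed.

(** * Color degrees in a set [R] outside the matching *)

Variable R : {set V}.
Hypothesis R_cover : forall w, w \in R -> w \notin cover M.
Hypothesis vR : v \notin R.

Lemma row_neq w : w \in R -> w != v.
Proof. by move=> wR; apply: contraNneq vR => <-. Qed.

Definition rows e := [set w in R | 0 < size (pcols (unused M) w e)].
(* Three rows allow a doubled edge to be exchanged for a free edge that avoids
   two given vertices. *)
Definition rich := [set e in doubled | 2 < #|rows e|].
(* Any two of these colors can be made unused simultaneously, one of them with
   the help of [v], the other with the help of a row. *)
Definition releasable : pred C :=
  [pred c | unused M c || (c \in [seq color G e | e in rich])].

Lemma rowsP e w : w \in rows e ->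
  w \in R /\ exists a, [/\ a \in e, adj w a & unused M (col w a)].
Proof. by rewrite inE => /andP[wR /size_pcols_gt0]. Qed.

Lemma richP e w w' : e \in rich ->
  exists2 w2, w2 \in rows e & (w2 != w) && (w2 != w').
Proof.
rewrite inE => /andP[_ r3].
have /subsetPn[w2 w2r w2n] : ~~ (rows e \subset [set w; w']).
  apply/negP => /subset_leq_card; rewrite cards2; lia.
by exists w2; rewrite // -negb_or; move: w2n; rewrite !inE.
Qed.

Lemma rich_doubled e : e \in rich -> e \in doubled.
Proof. by rewrite inE => /andP[]. Qed.

(** Some row differs from [w], while [doubled_color_blocked] would identify it with [w] if [z] lay
    off the undoubled edges. *)
Lemma rich_blocked e w z : e \in rich -> w \in R -> adj w z ->
  col w z = color G e -> z \in cover (M :\: doubled).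
Proof.
move=> er wR wz cwz; apply/negPn/negP => zN.
have [w2 w2r /andP[n2 _]] := richP w w er.
have [w2R [a [ae w2a fa]]] := rowsP w2r.
move/eqP: n2; apply.
by apply: (doubled_color_blocked (rich_doubled er) _ _ wz cwz zN _ _ ae);
   rewrite ?R_cover ?row_neq.
Qed.

Lemma releasable_compatible a b : [set a; b] \in M :\: doubled ->
  compatible G releasable R a b.
Proof.
move=> /setDP[eM eI] w w' wR w'R nw wa rwa w'b rw'b; apply/eqP/negPn/negP => nc.
have wM := R_cover wR; have w'M := R_cover w'R.
have wv := row_neq wR; have w'v := row_neq w'R.
have eM' : [set b; a] \in M by rewrite setUC.
have eI' : [set b; a] \notin doubled by rewrite setUC.
have nw' : w' != w by rewrite eq_sym.
case/orP: rwa => [fa|/imageP[e1 e1r c1]]; case/orP: rw'b => [fb|/imageP[e2 e2r c2]].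
- by move/eqP: nc; apply; apply: free_pair.
- by apply: (doubled_free_false (rich_doubled e2r) eM' eI' w'M wM) w'b c2 wa fa.
- by apply: (doubled_free_false (rich_doubled e1r) eM eI wM w'M) wa c1 w'b fb.
- have n12 : e1 != e2 by apply: contraNneq nc => E; rewrite c1 c2 E.
  have [w2 w2r /andP[n2 n2']] := richP w w' e2r.
  have [w2R [a2 [ae w2a fa]]] := rowsP w2r.
  by apply: (doubled2_false (rich_doubled e1r) (rich_doubled e2r) n12 eM eI
    wM w'M (R_cover w2R)) wa c1 w'b c2 ae w2a fa; rewrite ?row_neq.
Qed.

(** [v] is included so that it can be the vertex sending two colors in [sum_compatible_rigid]. *)
Lemma doubled_compatible a b : [set a; b] \in M ->
  compatible G (unused M) (v |: R) a b.
Proof.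
move=> eM w w' wR w'R nw wa fa w'b fb; apply: free_pair => //.
  by case/setU1P: wR => [->|/R_cover].
by case/setU1P: w'R => [->|/R_cover].
Qed.

Definition sees w e : bool :=
  color G e \in undup [seq color G f | f in [set f in edges G | w \in f]].

Lemma color_degree_row w : w \in R ->
  color_degree G w <= #|M :\: doubled|
    + \sum_(e in M :\: doubled) size (pcols releasable w e)
    + \sum_(e in doubled)
        (size (pcols (unused M) w e) + ((e \notin rich) && sees w e)).
Proof.
move=> wR.
pose L1 := [seq color G e | e in M :\: doubled].
pose L2 := flatten [seq pcols releasable w e | e in M :\: doubled].
pose L3 := flatten [seq pcols (unused M) w e | e in doubled].
pose L4 := [seq color G e | e in
             [set e in doubled | (e \notin rich) && sees w e]].
have sL2 : size L2 = \sum_(e in M :\: doubled) size (pcols releasable w e).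
  by rewrite size_flatten /shape -map_comp sumnE big_map big_enum.
have sL3 : size L3 = \sum_(e in doubled) size (pcols (unused M) w e).
  by rewrite size_flatten /shape -map_comp sumnE big_map big_enum.
have sL4 : size L4 = \sum_(e in doubled) ((e \notin rich) && sees w e : nat).
  rewrite size_image -sum1dep_card big_mkcondr /=.
  by apply: eq_bigr => e _; case: (_ && _).
rewrite big_split /= -sL2 -sL3 -sL4.
have <- : size L1 = #|M :\: doubled| by rewrite size_image.
rewrite addnA -!size_cat; apply: uniq_leq_size; first exact: undup_uniq.
move=> c /[dup] cw /color_degree_mem[z wz cE]; rewrite !mem_cat.
have [fc|/used_colorP[e eM ce]] := boolP (unused M c).
  have zM : z \in cover M.
    apply/negPn/negP => /(not_free_outside wz (R_cover wR)).
    by rewrite -cE fc.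
  case/bigcupP: zM => e eM ze; have [eI|eI] := boolP (e \in doubled).
    have -> : c \in L3; last by rewrite !orbT.
    apply/flatten_imageP; exists e => //.
    by apply/mem_pcols; exists z; rewrite -cE.
  have -> : c \in L2; last by rewrite !orbT.
  apply/flatten_imageP; exists e; first by rewrite inE eI.
  by apply/mem_pcols; exists z; rewrite -cE /releasable /= fc.
have [eI|eI] := boolP (e \in doubled); last first.
  have -> // : c \in L1.
  by apply/imageP; exists e; rewrite // inE eI.
have [er|er] := boolP (e \in rich); last first.
  have -> : c \in L4; last by rewrite !orbT.
  by apply/imageP; exists e => //; rewrite inE eI er /sees -ce.
have -> : c \in L2; last by rewrite !orbT.
have cwz : col w z = color G e by rewrite -cE.
have /bigcupP[f fN zf] := rich_blocked er wR wz cwz.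
apply/flatten_imageP; exists f => //; apply/mem_pcols; exists z; split=> //.
by rewrite cwz; apply/orP; right; apply/imageP; exists e.
Qed.

(** A rich edge has no [sees] term and receives at most [#|R|] free colors. Any other doubled edge
    has at most two rows and receives at most 2, besides at most [#|R|] from [sees]. Without
    undoubled edges, a row is the only vertex of [R] that can see the color of [e], so either the
    total is at most 3 or there are no free colors. *)
Lemma doubled_theta e : e \in doubled -> 2 < #|R| ->
  \sum_(w in R) (size (pcols (unused M) w e) + ((e \notin rich) && sees w e))
    <= #|R| + (if M :\: doubled == set0 then 0 else 2).
Proof.
move=> eI R3; have [eM eP] := doubledP eI; rewrite big_split /=.
have -> : \sum_(w in R) ((e \notin rich) && sees w e : nat)
    = #|[set w in R | (e \notin rich) && sees w e]|.
  rewrite -sum1dep_card big_mkcondr /=.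
  by apply: eq_bigr => w _; case: (_ && _).
set B := [set w in R | _ && _].
have sBR : B \subset R by apply/subsetP => w; rewrite /B inE => /andP[].
have leBR := subset_leq_card sBR.
have sum_le : \sum_(w in R) size (pcols (unused M) w e) <= maxn 2 #|rows e|.
  have [a [b [eab ab]]] := edge_ends (rainbow_edge rM eM).
  have [aP bP] : a \in Pv /\ b \in Pv.
    by split; apply: eP; rewrite eab ?set21 ?set22.
  rewrite /rows eab; apply: (sum_compatible_rigid (v := v)) => //.
    by apply: doubled_compatible; rewrite -eab.
  apply: pcols_gt1; rewrite ?adjPv ?freePv //.
  by apply: contra (adj_neq ab) => /eqP/injPv E; apply/eqP/E.
have [er|er] := boolP (e \in rich).
  have -> : B = set0.
    by apply/setP => w; rewrite in_set0 /B in_set er andbF.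
  have leR : #|rows e| <= #|R|.
    by apply/subset_leq_card/subsetP => w; rewrite inE => /andP[].
  by rewrite cards0; move: er; rewrite inE => /andP[_]; lia.
have r2 : #|rows e| <= 2 by move: er; rewrite inE eI /= -leqNgt.
case: eqVneq => [N0|_]; last by lia.
have [r0|/set0Pn[w2 w2r]] := eqVneq (rows e) set0.
  have -> : \sum_(w in R) size (pcols (unused M) w e) = 0.
    apply: big1 => w wR; apply/eqP; rewrite -leqn0 leqNgt; apply/negP => s0.
    have : w \in rows e by rewrite inE wR.
    by rewrite r0 inE.
  by rewrite addn0.
have [w2R [a [ae w2a fa]]] := rowsP w2r.
have sB2 : B \subset [set w2].
  apply/subsetP => w; rewrite /B !inE => /and3P[wR _ /color_degree_mem[z wz cE]].
  apply/eqP/esym.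
  apply: (doubled_color_blocked eI _ _ wz (esym cE) _ _ _ ae w2a fa);
    rewrite ?R_cover ?row_neq //.
  by rewrite N0 /cover big_set0 inE.
by move/subset_leq_card: sB2; rewrite cards1; lia.
Qed.

Lemma sum_color_degree_rows : 2 < #|R| ->
  \sum_(w in R) color_degree G w <= #|R| * #|M :\: doubled|
    + #|M :\: doubled| * #|R|.+1
    + #|doubled| * (#|R| + (if M :\: doubled == set0 then 0 else 2)).
Proof.
move=> R3; apply: leq_trans (leq_sum _ _) _; first exact: color_degree_row.
rewrite !big_split /= sum_nat_const !leq_add //.
  rewrite exchange_big /= -sum_nat_const; apply: leq_sum => e eN.
  have [a [b [eab _]]] := edge_ends (rainbow_edge rM (subsetP (subsetDl _ _) _ eN)).
  rewrite eab in eN *; apply: sum_compatible => //.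
  exact: releasable_compatible.
rewrite exchange_big /= -sum_nat_const; apply: leq_sum => e eI.
exact: doubled_theta.
Qed.

End Exchange.

(** * Representatives of colors and the counting step *)

Section Induction.

Local Open Scope nat_scope.

Variables (V : finType) (C : eqType).
Implicit Types (G : ecgraph V C) (M : {set {set V}}) (e f : {set V}).

(** A maximal subset on which [h] is injective meets every value of [h] on [A]. *)
Lemma distinct_representatives (h : V -> C) (A : {set V}) :
  exists B : {set V}, [/\ B \subset A, {in B &, injective h} &
    #|B| = size (undup [seq h x | x in A])].
Proof.
pose P (B : {set V}) := (B \subset A) && dinjectiveb h B.
have P0 : P set0.
  by rewrite /P sub0set; apply/dinjectiveP => x y; rewrite inE.
have [B /maxsetP[/andP[sBA /dinjectiveP iB] maxB] _] := maxset_exists P0.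
exists B; split=> //; rewrite -(size_image h B); apply/perm_size/uniq_perm.
- by rewrite map_inj_in_uniq ?enum_uniq // => x y; rewrite !mem_enum; apply: iB.
- exact: undup_uniq.
move=> c; rewrite mem_undup; apply/imageP/imageP => -[x xB ->].
  by exists x => //; apply: (subsetP sBA).
have [xiB|xiB] := boolP (h x \in [seq h y | y in B]).
  by case/imageP: xiB => y yB ->; exists y.
have nxy y : y \in B -> h x != h y.
  by move=> yB; apply: contraNneq xiB => ->; apply/imageP; exists y.
have xxB : x |: B = B.
  apply: maxB; last exact: subsetUr.
  rewrite /P subUset sub1set xB sBA; apply/dinjectiveP => y z.
  move=> /setU1P[->|yB] /setU1P[->|zB] E //; last exact: iB.
    by have := nxy z zB; rewrite E eqxx.
  by have := nxy y yB; rewrite -E eqxx.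
by exists x; rewrite // -xxB setU11.
Qed.

Lemma rainbow_dec G m : (exists M, rainbow G m M) \/ (forall M, ~ rainbow G m M).
Proof.
pose b (M : {set {set V}}) := [&& M \subset edges G, trivIset M,
  dinjectiveb (color G) M & #|M| == m].
have bP M : reflect (rainbow G m M) (b M).
  apply: (iffP and4P) => [[sM tM /dinjectiveP iM /eqP cM]|[[[sM tM] iM] /eqP cM]].
    by split.
  by split=> //; apply/dinjectiveP.
have [/existsP[M /bP rM]|/existsPn nM] := boolP [exists M, b M].
  by left; exists M.
by right=> M /bP; apply/negP/nM.
Qed.

Lemma card_cover_rainbow G m M : rainbow G m M -> #|cover M| = 2 * m.
Proof.
move=> rM; have [[[_ /eqP <-] _] cM] := rM.
rewrite (eq_bigr (fun=> 2)) => [|e /(rainbow_edge rM)/edges_card2 //].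
by rewrite sum_nat_const cM mulnC.
Qed.

Lemma color_degree_representatives G m M v : rainbow G m M ->
  (forall M', ~ rainbow G m.+1 M') -> v \notin cover M ->
  exists Pv : {set V}, [/\ Pv \subset cover M,
    forall z, z \in Pv -> adj G v z,
    forall z, z \in Pv -> unused G M (col G v z),
    {in Pv &, injective (col G v)} &
    color_degree G v <= m + #|Pv|].
Proof.
move=> rM maxM vM.
pose Z := [set z in cover M | adj G v z && unused G M (col G v z)].
have [Pv [sPZ iP cP]] := distinct_representatives (col G v) Z.
have PZ z : z \in Pv -> [/\ z \in cover M, adj G v z & unused G M (col G v z)].
  by move/(subsetP sPZ); rewrite inE => /and3P.
exists Pv; split=> // [|z /PZ[]|z /PZ[]|] //.
  by apply/subsetP => z /PZ[].
have [_ cM] := rM; rewrite cP -{1}cM -(size_image (color G)) -size_cat.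
apply: uniq_leq_size; first exact: undup_uniq.
move=> c /color_degree_mem[z vz cE]; rewrite mem_cat mem_undup.
have [uc|] := boolP (unused G M c); last by rewrite negbK => ->.
apply/orP; right; apply/imageP; exists z => //; rewrite inE vz -cE uc !andbT.
apply/negPn/negP => zM; have := not_free_outside rM maxM vz vM zM.
by rewrite -cE uc.
Qed.

(** An edge of [M] contains at most one point of [Pv] unless it is doubled. *)
Lemma card_doubled G m M (Pv : {set V}) : rainbow G m M -> Pv \subset cover M ->
  #|Pv| <= m + #|doubled M Pv|.
Proof.
move=> rM sP; have [_ cM] := rM.
have -> : m + #|doubled M Pv| = \sum_(e in M) (1 + (e \subset Pv)).
  rewrite big_split /= sum1_card cM /doubled -sum1dep_card big_mkcondr.
  by congr (_ + _); apply: eq_bigr => e _; case: (_ \subset _).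
have covP : Pv \subset \bigcup_(e in M) (Pv :&: e).
  apply/subsetP => z zP; have /bigcupP[e eM ze] := subsetP sP _ zP.
  by apply/bigcupP; exists e; rewrite // inE zP.
apply: leq_trans (subset_leq_card covP) _.
apply: leq_trans (_ : _ <= \sum_(e in M) #|Pv :&: e|) _.
  elim/big_rec2: _ => [|e n A _ IH]; first by rewrite cards0.
  by apply: leq_trans (leq_card_setU _ _) _; rewrite leq_add2l.
apply: leq_sum => e eM; have e2 := edges_card2 (rainbow_edge rM eM).
have leP : #|Pv :&: e| <= #|e| by apply/subset_leq_card/subsetIr.
have [|neP] := boolP (e \subset Pv); first by rewrite (leq_trans leP) ?e2.
rewrite addn0 leqNgt; apply/negP => gt1.
move/negP: neP; apply; apply/setIidPr/eqP.
by rewrite eqEcard subsetIr e2.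
Qed.

(* The hypothesis of the theorem for [k = m + 1]. *)
Definition dense m G (S : {set V}) : Prop :=
  [/\ forall e, e \in edges G -> e \subset S, 0 < #|S| &
      (2 * m + 1) * #|S| <= \sum_(u in S) color_degree G u].

Lemma rainbow_step m G (S : {set V}) v M : 1 < m -> dense m G S ->
  4 * m <= #|S| -> v \in S ->
  (forall u, u \in S -> color_degree G u <= color_degree G v) ->
  rainbow G m M -> v \notin cover M -> exists M', rainbow G m.+1 M'.
Proof.
move=> m1 [sS _ dS] S4 vS maxv rM vM.
have [//|maxM] := rainbow_dec G m.+1.
have [Pv [sP aP fP iP dv]] := color_degree_representatives rM maxM vM.
have cP := card_doubled rM sP.
have [_ cM] := rM.
have sM : cover M \subset S.
  by apply/bigcupsP => e /(rainbow_edge rM); apply: sS.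
pose R := (S :\: cover M) :\ v.
have RM w : w \in R -> w \notin cover M by rewrite !inE => /and3P[].
have vR : v \notin R by rewrite !inE eqxx.
have cS : #|S| = #|R| + 2 * m + 1.
  have := cardsD1 v (S :\: cover M); rewrite inE vM vS -/R.
  have := cardsID (cover M) S; rewrite (setIidPr sM) (card_cover_rainbow rM).
  by lia.
(* This uses [1 < m]: [#|R|] is at least [2m - 1]. *)
have R3 : 2 < #|R| by lia.
have := sum_color_degree_rows rM maxM vM aP fP iP RM vR R3.
have cN : #|M :\: doubled M Pv| + #|doubled M Pv| = m.
  have := cardsID (doubled M Pv) M.
  have /setIidPr-> : doubled M Pv \subset M.
    by apply/subsetP => e; rewrite inE => /andP[].
  by rewrite cM addnC.
have sumM : \sum_(u in cover M) color_degree G u <= 2 * m * color_degree G v.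
  rewrite -(card_cover_rainbow rM) -sum_nat_const; apply: leq_sum => u uM.
  by apply/maxv/(subsetP sM).
have sumS : \sum_(u in S) color_degree G u = \sum_(u in cover M) color_degree G u
    + (color_degree G v + \sum_(u in R) color_degree G u).
  rewrite (big_setID (cover M)) /= (setIidPr sM); congr (_ + _).
  by rewrite (big_setD1 v) // inE vM vS.
rewrite sumS cS in dS; rewrite cS in S4.
move: (\sum_(u in R) _) (\sum_(u in cover M) _) sumM dS => TR TM sumM dS.
set n := #|M :\: _| in cN *; set i := #|doubled _ _| in cN cP *.
have n0 : (M :\: doubled M Pv == set0) = (n == 0) by rewrite -cards_eq0.
rewrite n0 => leTR; move: (color_degree G v) (#|Pv|) (#|R|) dv cP sumM dS leTR S4 R3.
move=> d p r dv cP sumM dS leTR S4 R3; exfalso.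
have dle : d + n <= 3 * m by lia.
(* For [n = 0] an allowance of [r + 2] per doubled edge would permit equality at [r = 2m - 1]; the
   bound [r] valid in that case gives the contradiction. For [n > 0] the bounds miss by at least
   [3n]. *)
have [/eqP n_0|n_gt0] := boolP (n == 0).
  by rewrite n_0 eqxx /= in leTR; nia.
rewrite (negbTE n_gt0) in leTR; nia.
Qed.

(** * Vertex deletion and the base case *)

Lemma delete_vertex_card2 G (v : V) e :
  e \in [set f in edges G | v \notin f] -> #|e| = 2.
Proof. by rewrite inE => /andP[/edges_card2]. Qed.

(** The vertex type stays fixed and [v] becomes isolated; the loss is recorded by shrinking the set
    [S]. *)
Definition delete_vertex G v : ecgraph V C :=
  ECGraph (@delete_vertex_card2 G v) (color G).

Lemma rainbow_delete_vertex G v m M : rainbow (delete_vertex G v) m M ->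
  rainbow G m M /\ v \notin cover M.
Proof.
move=> [[[/subsetP sM tM] iM] cM]; split.
  split=> //; split=> //; split=> //.
  by apply/subsetP => e /sM; rewrite inE => /andP[].
by apply/bigcupP => -[e /sM]; rewrite inE => /andP[_ /negP].
Qed.

Lemma color_degree_delete_vertex G v u : u != v ->
  color_degree G u <= (color_degree (delete_vertex G v) u).+1.
Proof.
move=> uv; set G' := delete_vertex G v.
pose L := undup [seq color G' e | e in [set e in edges G' | u \in e]].
apply: (@uniq_leq_size _ _ (col G u v :: L)); first exact: undup_uniq.
move=> c /color_degree_mem[z uz ->]; rewrite inE.
have [->|zv] := eqVneq z v; first by rewrite eqxx.
apply/orP; right; apply/color_degree_mem; exists z => //.
have uzG : [set u; z] \in edges G := uz.
by rewrite /adj !inE uzG /= negb_or !(eq_sym v) uv.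
Qed.

Lemma color_degree_lt G (S : {set V}) u :
  (forall e, e \in edges G -> e \subset S) -> u \in S ->
  color_degree G u <= #|S :\ u|.
Proof.
move=> sS uS; rewrite -(size_image (col G u)).
apply: uniq_leq_size; first exact: undup_uniq.
move=> c /color_degree_mem[z uz ->]; apply/imageP; exists z => //.
have zS : z \in S by apply: (subsetP (sS _ uz)); rewrite set22.
by rewrite !inE zS andbT eq_sym (adj_neq uz).
Qed.

(** The sum loses at most [#|S| - 1] at [v] and at most 1 at each other vertex, which lowering the
    required average by 2 absorbs. *)
Lemma dense_delete_vertex m G (S : {set V}) v : dense m.+1 G S -> v \in S ->
  0 < #|S :\ v| -> dense m (delete_vertex G v) (S :\ v).
Proof.
move=> [sS S0 dS] vS S1; split=> //.
  move=> e; rewrite inE => /andP[eG ve]; rewrite subsetD1 ve andbT; exact: sS.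
have dv := color_degree_lt sS vS.
have le : \sum_(u in S :\ v) color_degree G u <=
    \sum_(u in S :\ v) (color_degree (delete_vertex G v) u + 1).
  apply: leq_sum => u; rewrite !inE addn1 => /andP[uv _].
  exact: color_degree_delete_vertex.
rewrite big_split /= sum_nat_const muln1 in le.
rewrite (big_setD1 v) //= in dS.
have cS := cardsD1 v S; rewrite vS in cS.
by rewrite cS in dS; nia.
Qed.

Lemma rainbow_edge1 G e : e \in edges G -> rainbow G 1 [set e].
Proof.
move=> eG; split; last exact: cards1.
split; first split.
- by rewrite sub1set.
- by apply/trivIsetP => f g /set1P-> /set1P->; rewrite eqxx.
- by move=> f g /set1P-> /set1P->.
Qed.

Lemma dense0_edge G (S : {set V}) : dense 0 G S -> exists e, e \in edges G.
Proof.
move=> [_ S0 dS]; apply/set0Pn; apply: contraTneq S0 => E0.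
rewrite -leqNgt; move: dS; rewrite mul1n big1 // => u _.
rewrite /color_degree /num_colors; have -> : [set e in edges G | u \in e] = set0.
  by apply/setP => e; rewrite E0 !inE.
by rewrite /image_mem enum_set0.
Qed.

(** * The case [m = 1]: rigidity and the properly colored K_4 *)

Section Dense1.

Variables (G : ecgraph V C) (S : {set V}).
Hypothesis dS : dense 1 G S.
Hypothesis S4 : 3 < #|S|.
Hypothesis maxG : forall M, ~ rainbow G 2 M.

Lemma dense1_sub e : e \in edges G -> e \subset S.
Proof. by case: dS => sS _ _; apply: sS. Qed.

Lemma dense1_avoiding_edge v : v \in S -> exists2 e, e \in edges G & v \notin e.
Proof.
move=> vS; have S0 : 0 < #|S :\ v| by have := cardsD1 v S; rewrite vS; lia.
have [e] := dense0_edge (dense_delete_vertex dS vS S0).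
by rewrite inE => /andP[]; exists e.
Qed.

Lemma dense1_ends v e : e \in edges G -> v \notin e ->
  exists Pv : {set V}, [/\ Pv \subset e,
    forall z, z \in Pv -> adj G v z,
    forall z, z \in Pv -> col G v z != color G e,
    {in Pv &, injective (col G v)} & color_degree G v <= #|Pv|.+1].
Proof.
move=> eG ve; have cov1 : cover [set e] = e by rewrite /cover big_set1.
have vM : v \notin cover [set e] by rewrite cov1.
have [Pv [sP aP fP iP dv]] := color_degree_representatives (rainbow_edge1 eG) maxG vM.
exists Pv; split=> //; first by rewrite -cov1.
by move=> z /fP/unusedP/(_ e (set11 e)); rewrite eq_sym.
Qed.

(** For an edge [e] avoiding [u], at most the two points of [e] are representatives, so no color
    degree exceeds 3, while the average is at least 3. *)
Lemma dense1_degree v : v \in S -> color_degree G v = 3.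
Proof.
have le3 u : u \in S -> color_degree G u <= 3.
  move=> uS; have [e eG ue] := dense1_avoiding_edge uS.
  have [Pu [sP _ _ _ du]] := dense1_ends eG ue.
  by apply: leq_trans du _; rewrite ltnS -(edges_card2 eG) subset_leq_card.
move=> vS; apply/eqP; rewrite eqn_leq le3 //.
have [_ _] := dS; rewrite (big_setD1 v) //=.
have : \sum_(u in S :\ v) color_degree G u <= #|S :\ v| * 3.
  by rewrite -sum_nat_const; apply: leq_sum => u /setD1P[_]; apply: le3.
by have := cardsD1 v S; rewrite vS; lia.
Qed.

(** Color degree 3 forces both ends of [xy] to be representatives for [v]. *)
Lemma dense1_triangle v x y : v \in S -> adj G x y -> v != x -> v != y ->
  [/\ adj G v x, col G v x != col G x y & col G v x != col G v y].
Proof.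
move=> vS xy vx vy; have ve : v \notin [set x; y] by rewrite !inE negb_or vx.
have [Pv [sP aP cP iP]] := dense1_ends xy ve; rewrite (dense1_degree vS) => P2.
have PE : Pv = [set x; y].
  by apply/eqP; rewrite eqEcard sP (edges_card2 xy).
have [xP yP] : x \in Pv /\ y \in Pv by rewrite PE set21 set22.
split; [exact: aP | exact: cP |].
by apply: contra (adj_neq xy) => /eqP/iP E; apply/eqP/E.
Qed.

(** An edge avoiding [y] gives [y] a neighbor [z]; if [z != x], then [x] is joined to both ends of
    [yz]. *)
Lemma dense1_complete x y : x \in S -> y \in S -> x != y -> adj G x y.
Proof.
move=> xS yS xy; have [e eG ye] := dense1_avoiding_edge yS.
have [z yz] : exists z, adj G y z.
  have [a [b [eab ab]]] := edge_ends eG; exists a.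
  have ya : y != a by apply: contraNneq ye => ->; rewrite eab set21.
  have yb : y != b by apply: contraNneq ye => ->; rewrite eab set22.
  by case: (dense1_triangle yS ab ya yb).
have [<-|zx] := eqVneq z x; first by rewrite adjC.
by have [] := dense1_triangle xS yz xy; rewrite // eq_sym.
Qed.

Lemma dense1_proper : properly_colored G.
Proof.
move=> e f eG fG ef /set0Pn[x /setIP[xe xf]].
have [y [ey xy]] := edge_other eG xe; have [z [ez xz]] := edge_other fG xf.
have yS : y \in S by apply: (subsetP (dense1_sub eG)); rewrite ey set22.
have yz : y != z by apply: contraNneq ef => yz; rewrite ey ez yz.
have yx : y != x by rewrite eq_sym (adj_neq xy).
have [_ + _] := dense1_triangle yS xz yx yz.
by rewrite ey ez colC.
Qed.

(** The edges from [v] to the rest of [S] have different colors, so there are at most 3 of them. *)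
Lemma dense1_card : #|S| = 4.
Proof.
have [v vS] : exists v, v \in S by apply/card_gt0P; lia.
have : #|S :\ v| <= color_degree G v.
  rewrite -(size_image (col G v)); apply: uniq_leq_size.
    rewrite map_inj_in_uniq ?enum_uniq // => x y; rewrite !mem_enum.
    move=> /setD1P[xv xS] /setD1P[yv yS] E; apply/eqP/negPn/negP => xy.
    have vx : adj G v x by apply: dense1_complete; rewrite // eq_sym.
    have vy : adj G v y by apply: dense1_complete; rewrite // eq_sym.
    have [_ + _] := dense1_triangle xS vy xv xy.
    by rewrite colC E eqxx.
  move=> c /imageP[x /setD1P[xv xS] ->]; apply/color_degree_mem.
  by exists x => //; apply: dense1_complete; rewrite // eq_sym.
by rewrite dense1_degree //; have := cardsD1 v S; rewrite vS; lia.
Qed.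

Lemma dense1_disjoint_color e f : e \in edges G -> f \in edges G ->
  [disjoint e & f] -> color G f = color G e.
Proof.
move=> eG fG ef; have [x [y [fxy xy]]] := edge_ends fG.
apply/eqP/negPn/negP => nc.
have cov1 : cover [set e] = e by rewrite /cover big_set1.
have nfe z : z \in f -> z \notin cover [set e].
  by move=> zf; rewrite cov1; apply/negP => ze; move/pred0P/(_ z): ef; rewrite /= ze zf.
apply: (maxG (rainbowU1 (rainbow_edge1 eG) xy _ _ _)).
- by apply: nfe; rewrite fxy set21.
- by apply: nfe; rewrite fxy set22.
- by apply/unusedP => g /set1P->; rewrite /col -fxy eq_sym.
Qed.

(** The complement of an edge is a disjoint edge, hence of the same color. *)
Lemma dense1_K4 : S = [set: V] -> is_K4_tilde G.
Proof.
move=> ST; have cV : #|V| = 4 by rewrite -cardsT -ST dense1_card.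
have compl : complete G.
  apply/setP => e; rewrite inE; apply/idP/idP => [/edges_card2-> //|].
  by case/cards2P => x [y [xy ->]]; apply: dense1_complete; rewrite ?ST ?inE.
have eC e : e \in edges G -> ~: e \in edges G /\ color G (~: e) = color G e.
  move=> eG; have eCG : ~: e \in edges G.
    by rewrite compl inE cardsCs setCK cV (edges_card2 eG).
  split=> //; apply: dense1_disjoint_color => //.
  by rewrite -setI_eq0 setICr.
have [v _] : exists v, v \in S by apply/card_gt0P; lia.
split=> //.
- exact: dense1_proper.
(* Of an edge and its complement one contains [v], so every color is among the three at [v]. *)
- rewrite -(@dense1_degree v) ?ST ?inE //; apply/perm_size/uniq_perm.
  + exact: undup_uniq.
  + exact: undup_uniq.
  move=> c; rewrite !mem_undup; apply/imageP/imageP => -[e]; last first.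
    by rewrite inE => /andP[eG _ ->]; exists e.
  move=> eG ->; have [ve|ve] := boolP (v \in e).
    by exists e; rewrite // inE eG.
  by have [eCG <-] := eC e eG; exists (~: e); rewrite // !inE eCG.
move=> e eG; split.
  split; first by apply/subsetP => f; rewrite inE => /andP[].
  apply/trivIsetP => f g; rewrite !inE => /andP[fG /eqP cf] /andP[gG /eqP cg] fg.
  rewrite -setI_eq0; apply/negPn/negP => /(dense1_proper fG gG fg).
  by rewrite cf cg eqxx.
have [eCG cC] := eC e eG.
apply/setP => x; rewrite inE; apply/bigcupP.
have [xe|xe] := boolP (x \in e); first by exists e; rewrite // inE eG eqxx.
by exists (~: e); rewrite !inE // eCG cC eqxx.
Qed.

End Dense1.

(** * The induction and the theorem *)

Lemma rainbow_step_induction m G (S : {set V}) : 1 < m ->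
  (forall G' (S' : {set V}), dense m.-1 G' S' -> 4 * m.-1 < #|S'| ->
    exists M, rainbow G' m M) ->
  dense m G S -> 4 * m <= #|S| -> exists M, rainbow G m.+1 M.
Proof.
move=> m1 IH dS S4; have [u uS] : exists u, u \in S by apply/card_gt0P; lia.
have [v vS maxv] := @arg_maxnP _ u [in S] (color_degree G) uS.
have cS := cardsD1 v S; rewrite vS in cS.
have dS' : dense m.-1 (delete_vertex G v) (S :\ v).
  by apply: dense_delete_vertex; rewrite ?prednK //; lia.
(* At least [4m - 1] vertices remain, more than [4(m - 1)], so only the strict inequality is passed
   down. *)
have [|M /rainbow_delete_vertex[rM vM]] := IH _ _ dS'; first by lia.
exact: (rainbow_step m1 dS S4 vS maxv rM vM).
Qed.

(** Strictness removes the exceptional graph: for [m = 1], failure would force [#|S| = 4]. *)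
Lemma rainbow_dense m G (S : {set V}) : dense m G S -> 4 * m < #|S| ->
  exists M, rainbow G m.+1 M.
Proof.
elim: m G S => [|m IH] G S dS S4.
  by have [e eG] := dense0_edge dS; exists [set e]; apply: rainbow_edge1.
case: m IH dS S4 => [_|m IH] dS S4.
  have [//|maxG] := rainbow_dec G 2.
  by have := dense1_card dS (ltnW S4) maxG; lia.
by apply: (@rainbow_step_induction m.+2 G S) => //; apply: ltnW.
Qed.

(** Equality is allowed here, so K_4 must be excluded when [m = 1]; from [m = 2] on, deleting one
    vertex leads to the strict case. *)
Lemma rainbow_dense_setT m G : dense m G [set: V] -> 4 * m <= #|V| ->
  ~ is_K4_tilde G -> exists M, rainbow G m.+1 M.
Proof.
move=> dG V4 nK; rewrite -cardsT in V4.
case: m dG V4 => [|[|m]] dG V4.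
- by have [e eG] := dense0_edge dG; exists [set e]; apply: rainbow_edge1.
- have [//|maxG] := rainbow_dec G 2.
  by case: nK; apply: (dense1_K4 dG).
- by apply: (@rainbow_step_induction m.+2 G [set: V]) => //; apply: rainbow_dense.
Qed.

End Induction.

Theorem theorem2 (V : finType) (C : eqType) (G : ecgraph V C) (k : nat)
    (k_gt0 : (0 < k)%N)
    (G_not_K4 : ~ is_K4_tilde G)
    (avg_ge : 2 * k%:R - 1 <= avg_color_degree G)
    (V_ge : (4 * k - 4 <= #|V|)%N) :
  exists2 M : {set {set V}}, rainbow_matching G M & #|M| = k.
Proof.
(* Without vertices the average is 0 by the convention on division, below [2k - 1]. *)
have V_gt0 : (0 < #|V|)%N.
  rewrite lt0n; apply: contraTneq avg_ge => V0.
  rewrite /avg_color_degree V0 invr0 mulr0 -ltNge subr_gt0.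
  by rewrite -natrM ltr1n; lia.
case: k k_gt0 avg_ge V_ge => // m _ avg_ge V_ge.
have dG : dense m G [set: V].
  split; [by move=> e _; apply: subsetT | by rewrite cardsT |].
  move: avg_ge; rewrite /avg_color_degree ler_pdivlMr ?ltr0n //.
  have -> : 2 * m.+1%:R - 1 = (2 * m + 1)%:R :> rat.
    have E : (2 * m.+1 = 2 * m + 1 + 1)%N by lia.
    by rewrite -natrM E natrD addrK.
  rewrite -natr_sum -natrM ler_nat cardsT.
  by rewrite (eq_bigl [in [set: V]]) // => v; rewrite inE.
have [|M [rM cM]] := rainbow_dense_setT dG _ G_not_K4; first by lia.
by exists M.
Qed.
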